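(* Let $M^{2n+1}(\varphi,Q,\xi,\eta,g)$ be a weak contact metric manifold, and let $\nabla$ be the Levi-Civita connection of $g$. Then $M$ is weak $K$-contact (that is, $\xi$ is a Killing vector field of $g$) if and only if $\nabla_X\,\xi=-\varphi X$ for all vector fields $X$ on $M$.
   Context: A weak almost contact structure on a smooth manifold $M^{2n+1}$ is a set $(\varphi,Q,\xi,\eta)$, where $\varphi$ is a $(1,1)$-tensor field, $Q$ is a nonsingular $(1,1)$-tensor field, $\xi$ is a vector field (the Reeb vector field) and $\eta$ is a 1-form with $\eta(\xi)=1$, satisfying $\varphi^2=-Q+\eta\otimes\xi$ and $Q\xi=\xi$; moreover, the distribution $\mathcal D=\ker\eta$ is assumed to be $\varphi$-invariant ($\varphi X\in\mathcal D$ for $X\in\mathcal D$). A weak almost contact metric structure $(\varphi,Q,\xi,\eta,g)$ is a weak almost contact structure together with a Riemannian metric $g$ such that $g(\varphi X,\varphi Y)=g(X,QY)-\eta(X)\eta(Y)$ for all vector fields $X,Y$. A weak contact metric structure is a weak almost contact metric structure such that $\Phi=d\eta$, where $\Phi(X,Y)=g(X,\varphi Y)$ and $d\eta(X,Y)=\frac12\{X(\eta(Y))-Y(\eta(X))-\eta([X,Y])\}$. A manifold with such a structure is called a weak contact metric manifold. A weak $K$-contact manifold is a weak contact metric manifold whose Reeb vector field $\xi$ is Killing, i.e., $\mathcal L_\xi g=0$. *)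

(* Defs.v *)
From HB Require Import structures.
From mathcomp Require Import all_boot all_order all_algebra.
From mathcomp Require Import all_classical all_reals all_analysis.
From mathcomp Require Import ring.

Set Implicit Arguments.
Unset Strict Implicit.
Unset Printing Implicit Defensive.

Import Order.TTheory GRing.Theory Num.Theory.
Import numFieldNormedType.Exports.

Local Open Scope classical_set_scope.
Local Open Scope ring_scope.

Section SmoothMaps.
Context {R : realType} {d : nat}.
Implicit Types (W : normedModType R) (U : set 'rV[R]_d).

(* C^k on U by iterated partial derivatives; meaningful for open U only *)
Fixpoint Ck W U (k : nat) (f : 'rV[R]_d -> W) : Prop :=
  {in U, continuous f} /\
  if k is k'.+1 then
    forall i : 'I_d, (forall x, U x -> derivable f x (delta_mx 0 i)) /\
                     Ck U k' (fun x => 'D_(delta_mx 0 i) f x)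
  else True.

Definition smooth_on W U (f : 'rV[R]_d -> W) := forall k, Ck U k f.

Let near_ext W U (f h : 'rV[R]_d -> W) x : open U ->
  (forall x, U x -> f x = h x) -> U x -> {near x, f =1 h}.
Proof. by move=> oU fh Ux; apply: filterS fh _; exact: open_nbhs_nbhs. Qed.

Let continuous_ext W U (f h : 'rV[R]_d -> W) : open U ->
  (forall x, U x -> f x = h x) -> {in U, continuous f} -> {in U, continuous h}.
Proof.
move=> oU fh fc x xU; have Ux := set_mem xU.
change (h y @[y --> x] --> h x); rewrite -(fh _ Ux).
apply: cvg_trans (fc _ xU); apply: (@near_eq_cvg _ _ (nbhs x)).
exact: near_ext oU fh Ux.
Qed.

Lemma Ck_ext W U k (f h : 'rV[R]_d -> W) :
  open U -> (forall x, U x -> f x = h x) -> Ck U k f -> Ck U k h.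
Proof.
move=> oU; elim: k f h => [|k IH] f h fh [fc fd].
  by split=> //; exact: continuous_ext fc.
split; first exact: continuous_ext fc.
move=> i; have [fdi fCi] := fd i; split.
  by move=> x Ux; apply: near_eq_derivable (near_ext oU fh Ux) (fdi _ Ux).
by apply: IH fCi => x Ux; apply: near_eq_derive; exact: near_ext oU fh Ux.
Qed.

Lemma CkW W U k (f : 'rV[R]_d -> W) : Ck U k.+1 f -> Ck U k f.
Proof.
elim: k f => [|k IH] f [fc fd]; split=> // i.
by have [? ?] := fd i; split=> //; exact: IH.
Qed.

Lemma Ck_cst W U k (a : W) : Ck U k (cst a : 'rV[R]_d -> W).
Proof.
elim: k a => [|k IH] a; (split; first by move=> x _; exact: cst_continuous).
  by [].
move=> i; split=> [x _|]; first exact: derivable_cst.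
rewrite (_ : (fun _ => _) = cst 0); first exact: IH.
by apply/funext => x; exact: derive_cst.
Qed.

Lemma Ck_add W U k (f h : 'rV[R]_d -> W) :
  open U -> Ck U k f -> Ck U k h -> Ck U k (f + h).
Proof.
move=> oU; elim: k f h => [|k IH] f h [fc fd] [hc hd].
  by split=> // x xU; apply: continuousD; [exact: fc|exact: hc].
split; first by move=> x xU; apply: continuousD; [exact: fc|exact: hc].
move=> i; have [fdi fCi] := fd i; have [hdi hCi] := hd i; split.
  by move=> x Ux; apply: derivableD; [exact: fdi|exact: hdi].
apply: Ck_ext (IH _ _ fCi hCi) => // x Ux.
by rewrite deriveD//; [exact: fdi|exact: hdi].
Qed.

Lemma Ck_mul U k (f h : 'rV[R]_d -> R) :
  open U -> Ck U k f -> Ck U k h -> Ck U k (f * h).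
Proof.
move=> oU; elim: k f h => [|k IH] f h fC hC.
  have [fc _] := fC; have [hc _] := hC.
  by split=> // x xU; apply: continuousM; [exact: fc|exact: hc].
have fC' := CkW fC; have hC' := CkW hC.
have [fc fd] := fC; have [hc hd] := hC.
split; first by move=> x xU; apply: continuousM; [exact: fc|exact: hc].
move=> i; have [fdi fCi] := fd i; have [hdi hCi] := hd i; split.
  by move=> x Ux; apply: derivableM; [exact: fdi|exact: hdi].
apply: Ck_ext (Ck_add oU (IH _ _ fC' hCi) (IH _ _ hC' fCi)) => // x Ux.
by rewrite deriveM//; [exact: fdi|exact: hdi].
Qed.

End SmoothMaps.

Section Manifolds.
Context (R : realType) (d : nat).

Record chart (M : topologicalType) := Chart {
  cdom : set M;
  ccod : set 'rV[R]_d;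
  cmap : M -> 'rV[R]_d;
  cinv : 'rV[R]_d -> M;
  cdom_open : open cdom;
  ccod_open : open ccod;
  cmap_cod : forall x, cdom x -> ccod (cmap x);
  cinv_dom : forall y, ccod y -> cdom (cinv y);
  cmapK : forall x, cdom x -> cinv (cmap x) = x;
  cinvK : forall y, ccod y -> cmap (cinv y) = y;
  cmap_cont : {in cdom, continuous cmap};
  cinv_cont : {in ccod, continuous cinv}
}.

Definition smooth_transition (M : topologicalType) (c c' : chart M) :=
  smooth_on (ccod c `&` cinv c @^-1` cdom c') (cmap c' \o cinv c).

(* The atlas need not be maximal: it determines the smooth structure. *)
Record smooth_manifold := SmoothManifold {
  carrier :> topologicalType;
  carrier_hausdorff : hausdorff_space carrier;
  carrier_second_countable : @second_countable carrier;
  atlas : set (chart carrier);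
  atlas_cover : forall x, exists2 c, atlas c & cdom c x;
  atlas_compat : forall c c', atlas c -> atlas c' -> smooth_transition c c'
}.

End Manifolds.

Section SmoothFunctions.
Context (R : realType) (d : nat) (M : smooth_manifold R d).

Definition smooth (f : M -> R) :=
  forall c, atlas c -> smooth_on (ccod c) (f \o cinv c).

Definition smoothb : {pred M -> R} := fun f => `[< smooth f >].

Lemma smooth_cst (a : R) : smooth (cst a).
Proof. by move=> c _ k; exact: Ck_cst. Qed.

Lemma smoothD (f h : M -> R) : smooth f -> smooth h -> smooth (f + h).
Proof.
move=> fs hs c Ac k; rewrite (_ : _ \o _ = (f \o cinv c) + (h \o cinv c))//.
by apply: Ck_add; [exact: ccod_open|exact: fs|exact: hs].
Qed.

Lemma smoothM (f h : M -> R) : smooth f -> smooth h -> smooth (f * h).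
Proof.
move=> fs hs c Ac k; rewrite (_ : _ \o _ = (f \o cinv c) * (h \o cinv c))//.
by apply: Ck_mul; [exact: ccod_open|exact: fs|exact: hs].
Qed.

Lemma smoothZ (a : R) (f : M -> R) : smooth f -> smooth (a *: f).
Proof.
move=> fs; rewrite (_ : a *: f = cst a * f)//.
by apply: smoothM => //; exact: smooth_cst.
Qed.

Lemma smoothN (f : M -> R) : smooth f -> smooth (- f).
Proof. by move=> fs; rewrite -scaleN1r; exact: smoothZ. Qed.

Fact smooth_subring : subring_closed smoothb.
Proof.
split=> [|f h|f h]; rewrite !inE.
- exact: smooth_cst.
- by move=> fs hs; apply: smoothD => //; exact: smoothN.
- exact: smoothM.
Qed.
HB.instance Definition _ :=
  GRing.isSubringClosed.Build (M -> R) smoothb smooth_subring.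

Fact smooth_scaler : GRing.scaler_closed smoothb.
Proof. by move=> a f; rewrite !inE; exact: smoothZ. Qed.
HB.instance Definition _ :=
  GRing.isScaleClosed.Build R (M -> R) smoothb smooth_scaler.

Record smoothfun := SmoothFun { sf_val :> M -> R; sf_prop : sf_val \in smoothb }.
HB.instance Definition _ := [isSub for sf_val].
HB.instance Definition _ := [Choice of smoothfun by <:].
HB.instance Definition _ := GRing.SubChoice_isSubComPzRing.Build (M -> R) smoothb smoothfun smooth_subring.
HB.instance Definition _ := [SubZmodule_isSubLmodule of smoothfun by <:].

Definition mk_smooth (f : M -> R) (fs : smooth f) : smoothfun :=
  SmoothFun (asboolT fs : f \in smoothb).

Lemma sf_smooth (f : smoothfun) : smooth f.
Proof. by have := sf_prop f; rewrite inE. Qed.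

Lemma sfP (f h : smoothfun) : (forall p, f p = h p) -> f = h.
Proof. by move=> fh; apply/val_inj/funext. Qed.

End SmoothFunctions.

Section TangentSpace.
Context (R : realType) (d : nat) (M : smooth_manifold R d).
Local Notation C := (smoothfun M).

Definition derivation_at (p : M) (v : C -> R) : Prop :=
  (forall a f h, v (a *: f + h) = a * v f + v h) /\
  (forall f h, v (f * h) = f p * v h + h p * v f).

Definition derivation_atb p : {pred C -> R} := fun v => `[< derivation_at p v >].

Fact derivation_submod p : submod_closed (derivation_atb p).
Proof.
split=> [|a v w]; rewrite !inE /derivation_at.
  by split=> *; rewrite !mulr0 addr0.
move=> [vl vm] [wl wm]; split=> [b f h|f h].
  rewrite !fctE; change (a * v (b *: f + h) + w (b *: f + h) =
    b * (a * v f + w f) + (a * v h + w h)); rewrite vl wl; ring.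
change (a * v (f * h) + w (f * h) =
    f p * (a * v h + w h) + h p * (a * v f + w f)); rewrite vm wm; ring.
Qed.
HB.instance Definition _ p :=
  GRing.isSubmodClosed.Build R (C -> R) (derivation_atb p) (derivation_submod p).

Record tangent (p : M) :=
  Tangent { tg_val :> C -> R; tg_prop : tg_val \in derivation_atb p }.
HB.instance Definition _ p := [isSub for @tg_val p].
HB.instance Definition _ p := [Choice of tangent p by <:].
HB.instance Definition _ p := [SubChoice_isSubLmodule of tangent p by <:].

Lemma tangentP p (v w : tangent p) : (forall f, v f = w f) -> v = w.
Proof. by move=> vw; apply/val_inj/funext. Qed.

Lemma tg_der p (v : tangent p) : derivation_at p v.
Proof. by have := tg_prop v; rewrite inE. Qed.

Definition mk_tangent p (v : C -> R) (vd : derivation_at p v) : tangent p :=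
  Tangent (asboolT vd : v \in derivation_atb p).

End TangentSpace.

Section VectorFields.
Context (R : realType) (d : nat) (M : smooth_manifold R d).
Local Notation C := (smoothfun M).

Definition smooth_section (X : forall p : M, tangent p) :=
  forall f : C, smooth (fun p => X p f).

Record vfield := VField {
  vf_val :> forall p : M, tangent p;
  vf_smooth : smooth_section vf_val
}.

Lemma vfieldP (X Y : vfield) : (forall p, X p = Y p) -> X = Y.
Proof.
case: X Y => [X sX] [Y sY] /= XY.
have {}XY : X = Y by exact: functional_extensionality_dep.
by subst Y; congr VField; exact: Prop_irrelevance.
Qed.

HB.instance Definition _ := gen_eqMixin vfield.
HB.instance Definition _ := gen_choiceMixin vfield.

Definition vact (X : vfield) (f : C) : C := mk_smooth (vf_smooth X f).

Fact vf_add_smooth (X Y : vfield) : smooth_section (fun p => X p + Y p).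
Proof. by move=> f; exact: (smoothD (vf_smooth X f) (vf_smooth Y f)). Qed.

Fact vf_zero_smooth : smooth_section (fun p => 0).
Proof. by move=> f; exact: (smooth_cst 0). Qed.

Fact vf_opp_smooth (X : vfield) : smooth_section (fun p => - X p).
Proof. by move=> f; exact: (smoothN (vf_smooth X f)). Qed.

Fact vf_scale_smooth (f : C) (X : vfield) : smooth_section (fun p => f p *: X p).
Proof. by move=> h; exact: (smoothM (sf_smooth f) (vf_smooth X h)). Qed.

Definition vf_add X Y := VField (vf_add_smooth X Y).
Definition vf_zero := VField vf_zero_smooth.
Definition vf_opp X := VField (vf_opp_smooth X).
Definition vf_scale f X := VField (vf_scale_smooth f X).

Fact vf_addA : associative vf_add.
Proof. by move=> X Y Z; apply: vfieldP => p; exact: addrA. Qed.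
Fact vf_addC : commutative vf_add.
Proof. by move=> X Y; apply: vfieldP => p; exact: addrC. Qed.
Fact vf_add0 : left_id vf_zero vf_add.
Proof. by move=> X; apply: vfieldP => p; exact: add0r. Qed.
Fact vf_addN : left_inverse vf_zero vf_opp vf_add.
Proof. by move=> X; apply: vfieldP => p; exact: addNr. Qed.

HB.instance Definition _ :=
  GRing.isZmodule.Build vfield vf_addA vf_addC vf_add0 vf_addN.

Fact vf_scaleA (f h : C) X : vf_scale f (vf_scale h X) = vf_scale (f * h) X.
Proof. by apply: vfieldP => p; exact: scalerA. Qed.
Fact vf_scale1 : left_id (1 : C) vf_scale.
Proof. by move=> X; apply: vfieldP => p; exact: scale1r. Qed.
Fact vf_scaleDr : right_distributive vf_scale +%R.
Proof. by move=> f X Y; apply: vfieldP => p; exact: scalerDr. Qed.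
Fact vf_scaleDl X : {morph vf_scale^~ X : f h / f + h}.
Proof. by move=> f h; apply: vfieldP => p; exact: scalerDl. Qed.

HB.instance Definition _ := GRing.Zmodule_isLmodule.Build C vfield
  vf_scaleA vf_scale1 vf_scaleDr vf_scaleDl.

Fact bracket_derivation (X Y : vfield) p :
  derivation_at p (fun f => X p (vact Y f) - Y p (vact X f)).
Proof.
have lin (Z : vfield) a f h : vact Z (a *: f + h) = a *: vact Z f + vact Z h.
  by apply: sfP => q; exact: (tg_der (Z q)).1.
have leib (Z : vfield) f h : vact Z (f * h) = f * vact Z h + h * vact Z f.
  by apply: sfP => q; exact: (tg_der (Z q)).2.
have tD (v : tangent p) f h : v (f + h) = v f + v h.
  by have := (tg_der v).1 1 f h; rewrite scale1r mul1r.
split=> [a f h|f h].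
  by rewrite !lin !(tg_der _).1; ring.
rewrite !leib !tD !(tg_der _).2 /=; ring.
Qed.

Fact bracket_smooth (X Y : vfield) :
  smooth_section (fun p => mk_tangent (bracket_derivation X Y p)).
Proof.
move=> f; exact: (smoothD (vf_smooth X (vact Y f))
                          (smoothN (vf_smooth Y (vact X f)))).
Qed.

Definition bracket X Y : vfield := VField (bracket_smooth X Y).

End VectorFields.

Section Tensors.
Context (R : realType) (d : nat) (M : smooth_manifold R d).
Local Notation C := (smoothfun M).
Local Notation vfield := (vfield M).

(* A tensor field is a family of tensors on the tangent spaces; since global
   vector fields span every tangent space, it is smooth iff its values on smooth
   vector fields are smooth. *)
Record tensor11 := Tensor11 {
  t11_val :> forall p : M, {linear tangent p -> tangent p};
  t11_smooth : forall X : vfield, smooth_section (fun p => t11_val p (X p))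
}.

Record one_form := OneForm {
  of_val :> forall p : M, {linear tangent p -> R^o};
  of_smooth : forall X : vfield, smooth (fun p => of_val p (X p))
}.

Record riemannian_metric := RiemannianMetric {
  rm_val :> forall p : M, tangent p -> tangent p -> R;
  rm_sym : forall p (v w : tangent p), rm_val v w = rm_val w v;
  rm_linear : forall p a (u v w : tangent p),
    rm_val (a *: v + w) u = a * rm_val v u + rm_val w u;
  rm_pos : forall p (v : tangent p), v != 0 -> 0 < rm_val v v;
  rm_smooth : forall X Y : vfield, smooth (fun p => rm_val (X p) (Y p))
}.

Definition t11_app (phi : tensor11) (X : vfield) : vfield :=
  VField (t11_smooth phi X).
Definition of_app (eta : one_form) (X : vfield) : C :=
  mk_smooth (of_smooth eta X).
Definition rm_app (g : riemannian_metric) (X Y : vfield) : C :=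
  mk_smooth (rm_smooth g X Y).

(* This normalization of the exterior derivative includes the factor 1/2. *)
Definition ext_der (eta : one_form) (X Y : vfield) : C :=
  2^-1 *: (vact X (of_app eta Y) - vact Y (of_app eta X)
           - of_app eta (bracket X Y)).

(* (L_xi g)(X, Y), with L_xi acting as a tensor derivation *)
Definition lie_metric (xi : vfield) (g : riemannian_metric) (X Y : vfield) : C :=
  vact xi (rm_app g X Y) - rm_app g (bracket xi X) Y - rm_app g X (bracket xi Y).

Definition killing (g : riemannian_metric) (xi : vfield) :=
  forall X Y, lie_metric xi g X Y = 0.

(* R-linearity in the second argument follows from additivity and the Leibniz
   rule for constant functions. *)
Definition affine_connection (nabla : vfield -> vfield -> vfield) :=
  [/\ forall (f : C) X Y Z, nabla (f *: X + Y) Z = f *: nabla X Z + nabla Y Z,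
      forall X Y Z, nabla X (Y + Z) = nabla X Y + nabla X Z
    & forall X (f : C) Y, nabla X (f *: Y) = vact X f *: Y + f *: nabla X Y].

Definition torsion_free (nabla : vfield -> vfield -> vfield) :=
  forall X Y, nabla X Y - nabla Y X = bracket X Y.

Definition metric_compatible (g : riemannian_metric)
    (nabla : vfield -> vfield -> vfield) :=
  forall X Y Z,
    vact X (rm_app g Y Z) = rm_app g (nabla X Y) Z + rm_app g Y (nabla X Z).

Definition levi_civita (g : riemannian_metric)
    (nabla : vfield -> vfield -> vfield) :=
  [/\ affine_connection nabla, torsion_free nabla & metric_compatible g nabla].

End Tensors.

Section WeakContact.
Context (R : realType) (n : nat) (M : smooth_manifold R (2 * n).+1).
Implicit Types (phi Q : tensor11 M) (xi : vfield M) (eta : one_form M)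
  (g : riemannian_metric M).

Record weak_almost_contact phi Q xi eta : Prop := {
  wac_nonsingular : forall p, bijective (Q p);
  wac_eta_xi : forall p, eta p (xi p) = 1;
  wac_phi2 : forall p v, phi p (phi p v) = - Q p v + eta p v *: xi p;
  wac_Q_xi : forall p, Q p (xi p) = xi p;
  (* ker eta is phi-invariant *)
  wac_invariant : forall p v, eta p v = 0 -> eta p (phi p v) = 0
}.

Definition weak_almost_contact_metric phi Q xi eta g : Prop :=
  weak_almost_contact phi Q xi eta /\
  forall X Y : vfield M,
    rm_app g (t11_app phi X) (t11_app phi Y) =
    rm_app g X (t11_app Q Y) - of_app eta X * of_app eta Y.

Definition fundamental_form phi g (X Y : vfield M) : smoothfun M :=
  rm_app g X (t11_app phi Y).

Definition weak_contact_metric phi Q xi eta g : Prop :=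
  weak_almost_contact_metric phi Q xi eta g /\
  forall X Y, fundamental_form phi g X Y = ext_der eta X Y.

Definition weak_K_contact phi Q xi eta g : Prop :=
  weak_contact_metric phi Q xi eta g /\ killing g xi.

End WeakContact.

(* Main.v *)
Require Import Defs.
From mathcomp Require Import all_boot all_order all_algebra.
From mathcomp Require Import all_classical all_reals all_analysis.
From mathcomp Require Import ring.
Import GRing.Theory.
Local Open Scope ring_scope.

(** Since [eta X = g(X, xi)], metricity and torsion-freeness give
    [g(nabla_X xi, Y) - g(nabla_Y xi, X) = 2 d eta(X, Y) = 2 g(X, phi Y)], while
    [(L_xi g)(X, Y) = g(nabla_X xi, Y) + g(nabla_Y xi, X)].  So the skew part of
    [nabla xi] is always [-phi], and [xi] is Killing iff the symmetric part
    vanishes. *)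

Section RiemannianMetric.
Context {R : realType} {d : nat} {M : smooth_manifold R d}.
Implicit Types (g : riemannian_metric M) (X Y Z : vfield M).

Lemma rm_appC g X Y : rm_app g X Y = rm_app g Y X.
Proof. by apply: sfP => p; exact: rm_sym. Qed.

Lemma rm_appDl g X Y Z : rm_app g (X + Y) Z = rm_app g X Z + rm_app g Y Z.
Proof.
apply: sfP => p.
by have := rm_linear g (1 : R) (Z p) (X p) (Y p); rewrite scale1r mul1r.
Qed.

Lemma rm_app0l g X : rm_app g 0 X = 0.
Proof. by apply: (addrI (rm_app g 0 X)); rewrite -rm_appDl !addr0. Qed.

Lemma rm_appNl g X Y : rm_app g (- X) Y = - rm_app g X Y.
Proof.
by apply: (addrI (rm_app g X Y)); rewrite -rm_appDl !subrr rm_app0l.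
Qed.

Lemma rm_appBl g X Y Z : rm_app g (X - Y) Z = rm_app g X Z - rm_app g Y Z.
Proof. by rewrite rm_appDl rm_appNl. Qed.

Lemma rm_appBr g X Y Z : rm_app g X (Y - Z) = rm_app g X Y - rm_app g X Z.
Proof. by rewrite ![rm_app g X _]rm_appC rm_appBl. Qed.

(** Positivity of [g], tested on the global field [Z := X - Y], so that no tangent vector has to be
    extended to a vector field. *)
Lemma rm_app_inj g X Y :
  (forall Z, rm_app g X Z = rm_app g Y Z) -> X = Y.
Proof.
move=> XY; apply/eqP; rewrite -subr_eq0; apply/eqP; apply: vfieldP => p.
have [//|nz] := eqVneq ((X - Y) p) 0.
have gp : rm_app g (X - Y) (X - Y) p = 0 by rewrite rm_appBl XY subrr.
by have := rm_pos g nz; rewrite -[ltRHS]/(rm_app g (X - Y) (X - Y) p) gp Order.POrderTheory.ltxx.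
Qed.

(** With [[xi, X] = nabla_xi X - nabla_X xi], the [nabla_xi] terms cancel against those of
    [xi(g(X, Y))]. *)
Lemma lie_metricE {g nabla} {xi : vfield M} X Y : levi_civita g nabla ->
  lie_metric xi g X Y = rm_app g (nabla X xi) Y + rm_app g (nabla Y xi) X.
Proof.
move=> [_ tf mc]; rewrite /lie_metric mc -!tf rm_appBl rm_appBr.
rewrite (rm_appC g (nabla Y xi)); ring.
Qed.

(** The terms of [X(g(Y, xi)) - Y(g(X, xi))] that differentiate [X] and [Y] add up to [g([X, Y],
    xi)], which [eta([X, Y])] removes. *)
Lemma ext_der_dualE {g nabla} {eta : one_form M} {xi : vfield M} X Y :
    levi_civita g nabla -> (forall X, of_app eta X = rm_app g X xi) ->
  ext_der eta X Y =
  2^-1 *: (rm_app g (nabla X xi) Y - rm_app g (nabla Y xi) X).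
Proof.
move=> [_ tf mc] dual; rewrite /ext_der !dual !mc -tf rm_appBl; congr (_ *: _).
rewrite (rm_appC g Y (nabla X xi)) (rm_appC g X (nabla Y xi)); ring.
Qed.

End RiemannianMetric.

Section WeakContactMetric.
Context {R : realType} {n : nat} {M : smooth_manifold R (2 * n).+1}.
Context {phi Q : tensor11 M} {xi : vfield M} {eta : one_form M}.
Context {g : riemannian_metric M}.

Lemma phi_xi : weak_almost_contact phi Q xi eta -> forall p, phi p (xi p) = 0.
Proof.
move=> [Qbij eta_xi phi2 Q_xi _] p.
have phiphi : phi p (phi p (xi p)) = 0.
  by rewrite phi2 Q_xi eta_xi scale1r addNr.
(* [phi^3 xi = 0] makes [phi xi] a multiple of [xi], killed by [phi^2 xi = 0]. *)
have phixi : phi p (xi p) = eta p (phi p (xi p)) *: xi p.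
  apply: (bij_inj (Qbij p)); rewrite linearZ /= Q_xi.
  by have := phi2 p (phi p (xi p)); rewrite phiphi linear0 addrC => /esym/subr0_eq.
move: phiphi phixi; set c := eta p _ => phiphi phixi.
(* Applying [eta] to [phi^2 xi = 0] gives the scalar equation [c * c = 0]. *)
have : eta p (phi p (phi p (xi p))) = 0 by rewrite phiphi linear0.
rewrite phixi linearZ /= linearZ /= -/c => /eqP.
by rewrite -[_ *: _]/(c * c) mulf_eq0 orbb => /eqP->; rewrite scale0r.
Qed.

(** Metric compatibility at [Y = xi]: its left side vanishes by [phi_xi], leaving
    [0 = g(X, xi) - eta X]. *)
Lemma eta_dual : weak_almost_contact_metric phi Q xi eta g ->
  forall X, of_app eta X = rm_app g X xi.
Proof.
move=> [wac compat] X; have := compat X xi.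
have -> : t11_app phi xi = 0 by apply: vfieldP => p; exact: phi_xi.
have -> : t11_app Q xi = xi by apply: vfieldP => p; exact: (wac_Q_xi wac).
have -> : of_app eta xi = 1 by apply: sfP => p; exact: (wac_eta_xi wac).
by rewrite rm_appC rm_app0l mulr1 => /esym/subr0_eq.
Qed.

End WeakContactMetric.

Theorem theorem3p1 (R : realType) (n : nat) (M : smooth_manifold R (2 * n).+1)
    (phi Q : tensor11 M) (xi : vfield M) (eta : one_form M)
    (g : riemannian_metric M) (nabla : vfield M -> vfield M -> vfield M)
    (hS : weak_contact_metric phi Q xi eta g) (hnabla : levi_civita g nabla) :
  weak_K_contact phi Q xi eta g <->
  (forall X : vfield M, nabla X xi = - t11_app phi X).
Proof.
have [wacm Phi_d] := hS.
have skew X Y : rm_app g X (t11_app phi Y) =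
    2^-1 *: (rm_app g (nabla X xi) Y - rm_app g (nabla Y xi) X).
  by rewrite -(ext_der_dualE X Y hnabla (eta_dual wacm)); exact: Phi_d.
(* [phi] is skew for [g] because the right side of [skew] changes sign when [X] and [Y] are
   swapped. *)
have phiC X Y : rm_app g (- t11_app phi X) Y = rm_app g X (t11_app phi Y).
  by rewrite rm_appNl rm_appC !skew -scalerN opprB.
split=> [[_ kil] X|nablaE].
  apply: (rm_app_inj g) => Y; rewrite phiC skew.
  have /eqP := kil X Y; rewrite (lie_metricE _ _ hnabla) addr_eq0 => /eqP sym.
  (* For Killing [xi] the two terms of [skew] are opposite, so half their difference is
     [g(nabla_X xi, Y)]. *)
  have -> : rm_app g (nabla Y xi) X = - rm_app g (nabla X xi) Y.
    by rewrite sym opprK.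
  by rewrite opprK -mulr2n -scalerMnr scalerMnl -mulr_natr mulVf ?scale1r // Num.Theory.pnatr_eq0.
(* The Lie derivative becomes [g(- phi X, Y) + g(- phi Y, X)], which is zero since [phi] is skew. *)
split=> // X Y; rewrite (lie_metricE _ _ hnabla) !nablaE phiC.
by rewrite rm_appNl (rm_appC g X) subrr.
Qed.
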